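(* Let $\{x_k\}$ be a sequence of real numbers converging to $x_*$ with $x_k \neq x_*$ for all large $k$. Let $p \in \mathbb{N}$ and $\alpha \geq 1$. If $\{x_k\}$ has $p$-step Q-order at least $\alpha$, then $\{x_k\}$ has R-order at least $\alpha$.
   Context: $\mathbb{N} = \{1,2,\dots\}$; sequences are indexed by integers $k \geq 0$. For a sequence $\{x_k\}$ of real numbers converging to $x_*$, with $x_k \neq x_*$ for all large $k$, put $e_k = |x_k - x_*|$. All quotients below are considered for $k$ large enough that they are defined, and limits superior are taken in $[0,+\infty]$. $p$-step Q-order: for $p \in \mathbb{N}$ and $\alpha \geq 1$ define $$Q_1^{(p)}(x_k) = \left(\frac{e_{k+p}}{e_k}\right)^{1/p}, \qquad Q_\alpha^{(p)}(x_k) = \left(\frac{e_{k+p}}{e_k^{\alpha^p}}\right)^{\frac{\alpha-1}{\alpha^p-1}} \ \text{ if } \alpha>1, \qquad \overline{Q}_\alpha^{(p)}(x_k) = \limsup_{k\to\infty} Q_\alpha^{(p)}(x_k).$$ The sequence $\{x_k\}$ has (converges with) $p$-step Q-order at least $1$ if $\overline{Q}_1^{(p)}(x_k) < 1$, and has $p$-step Q-order at least $\alpha$, for $\alpha > 1$, if $\overline{Q}_\alpha^{(p)}(x_k) < \infty$. Q-order: a convergent sequence (with terms different from its limit for all large $k$ and errors $e_k$) has Q-order at least $1$ if $\limsup_{k\to\infty} e_{k+1}/e_k < 1$, and has Q-order at least $\alpha$, for $\alpha>1$, if $\limsup_{k\to\infty} e_{k+1}/e_k^{\alpha} < \infty$.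 R-order: for $\alpha \geq 1$, a sequence $\{x_k\}$ converges to $x_*$ with R-order at least $\alpha$ if there exists a sequence $\{\beta_k\}$ of positive real numbers with $e_k \leq \beta_k$ for all sufficiently large $k$, converging to zero with Q-order at least $\alpha$. *)

(* Defs.v *)
From HB Require Import structures.
From mathcomp Require Import all_boot all_order all_algebra.
From mathcomp Require Import all_classical all_reals all_analysis.
Set Implicit Arguments.
Unset Strict Implicit.
Unset Printing Implicit Defensive.
Import Order.TTheory GRing.Theory Num.Theory.
Import numFieldNormedType.Exports.
Local Open Scope classical_set_scope.
Local Open Scope ring_scope.

Definition err (R : realType) (x : R^nat) (xs : R) (k : nat) : R :=
  `|x k - xs|.

(* The order predicates below are meant for sequences x that converge to xs
   with x k != xs for all large k. Division and powR are total, so the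
   quotients have arbitrary real values at the finitely many k with
   x k = xs; these values do not affect the superior limits, which are taken
   in \bar R. *)

Definition Qfactor (R : realType) (p : nat) (alpha : R)
    (x : R^nat) (xs : R) (k : nat) : R :=
  if alpha == 1 then (err x xs (k + p)%N / err x xs k) `^ (p%:R^-1)
  else (err x xs (k + p)%N / err x xs k `^ (alpha ^+ p))
         `^ ((alpha - 1) / (alpha ^+ p - 1)).

Definition Qbar (R : realType) (p : nat) (alpha : R)
    (x : R^nat) (xs : R) : \bar R :=
  limn_esup (fun k => (Qfactor p alpha x xs k)%:E).

Definition pstep_Qorder_ge (R : realType) (p : nat) (alpha : R)
    (x : R^nat) (xs : R) : Prop :=
  (alpha = 1 /\ (Qbar p alpha x xs < 1)%E) \/
  (1 < alpha /\ (Qbar p alpha x xs < +oo)%E).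

Definition Qorder_ge (R : realType) (alpha : R) (x : R^nat) (xs : R) : Prop :=
  (alpha = 1 /\
     (limn_esup (fun k => (err x xs k.+1 / err x xs k)%:E) < 1)%E) \/
  (1 < alpha /\
     (limn_esup (fun k => (err x xs k.+1 / err x xs k `^ alpha)%:E) < +oo)%E).

Definition Rorder_ge (R : realType) (alpha : R) (x : R^nat) (xs : R) : Prop :=
  exists beta : R^nat,
    [/\ forall k, 0 < beta k,
        \forall k \near \oo, err x xs k <= beta k,
        beta @ \oo --> (0 : R)
      & Qorder_ge alpha beta 0].

(* Main.v *)
Require Import Defs.
From mathcomp Require Import all_boot all_order all_algebra.
From mathcomp Require Import all_classical all_reals all_analysis.
From mathcomp Require Import ring lra zify.
Import Order.TTheory GRing.Theory Num.Theory.
Import numFieldNormedType.Exports.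
Local Open Scope classical_set_scope.
Local Open Scope ring_scope.

(** The hypothesis gives, for large [k], [e_(k+p) <= q^p e_k] with [q < 1] when
    [alpha = 1], and [e_(k+p) <= L e_k^A] with [A = alpha^p] when [alpha > 1].
    The sequences [C q^k] and [exp (l - s alpha^k)] with [l = - ln L / (A - 1)]
    satisfy the respective recursion with equality, so that they dominate [e]
    from index [K] on as soon as they dominate it on [K, K + p). The latter is
    arranged by taking [C] large, respectively [s > 0] small, because [e]
    tends to 0. *)

Lemma step_ind (P : nat -> Prop) (K p : nat) : (0 < p)%N ->
  (forall j, (K <= j < K + p)%N -> P j) ->
  (forall k, (K <= k)%N -> P k -> P (k + p)%N) ->
  forall k, (K <= k)%N -> P k.
Proof.
move=> p0 P0 PS; elim/ltn_ind => k IH Kk.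
have [kKp|Kpk] := ltnP k (K + p); first by apply: P0; rewrite Kk.
rewrite -(@subnK p k); last by lia.
apply: PS; first by lia.
by apply: IH; lia.
Qed.

(** The upper limit is an infimum of suprema over neighbourhoods of infinity, so one of these
    suprema is below [b]. This excludes [+oo], and nonemptiness of the neighbourhood excludes [-oo];
    the supremum is the real [r]. *)
Lemma limn_esup_lt_bound {R : realType} {u : R^nat} {b : \bar R} :
  (limn_esup (fun k => (u k)%:E) < b)%E ->
  exists2 r : R, (r%:E < b)%E & \forall k \near \oo, u k <= r.
Proof.
rewrite /limn_esup limf_esupE => /ereal_inf_lt[_ [V [n _ nV] <-] supb].
have uV k : (n <= k)%N -> ((u k)%:E <= ereal_sup [set (u x)%:E | x in V])%E.
  by move=> nk; apply: ereal_sup_ubound; exists k => //; exact: nV.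
move: supb uV; case: ereal_sup => [r rb uV||_ /(_ n (leqnn n))].
- by exists r => //; exists n => // k /uV; rewrite lee_fin.
- by move=> /[swap] _; rewrite ltNge leey.
- by rewrite leeNy_eq.
Qed.

(** Both comparison sequences have Q-quotients independent of [k]. *)
Lemma limn_esup_cst {R : realType} (u : (\bar R)^nat) (c : \bar R) :
  (forall k, u k = c) -> limn_esup u = c.
Proof.
move=> uc; have -> : u = cst c by apply/funext.
by apply: (cvg_limn_einf_sup _).2; exact: cvg_cst.
Qed.

(** Serves to undo the outer exponent of [Qfactor]. *)
Lemma le_powR_inv {R : realType} {a c r : R} :
  0 <= a -> 0 < c -> a `^ c <= r -> a <= r `^ c^-1.
Proof.
move=> a0 c0 ar.
rewrite -[leLHS]powRr1// -(@divff _ c) ?gt_eqF// powRrM.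
by apply: ge0_ler_powR => //; rewrite ?invr_ge0 ?ltW// nnegrE ?powR_ge0//
  (le_trans _ ar) ?powR_ge0.
Qed.

Lemma near_err_le {R : realType} {x : R^nat} {xs : R} (c : R) : 0 < c ->
  x @ \oo --> xs -> \forall k \near \oo, err x xs k <= c.
Proof.
move=> c0 /cvgr_dist_lt/(_ _ c0); apply: filterS => k /ltW.
by rewrite /err distrC.
Qed.

Lemma err_gt0 {R : realType} (x : R^nat) (xs : R) (k : nat) :
  x k != xs -> 0 < err x xs k.
Proof. by rewrite /err normr_gt0 subr_eq0. Qed.

Lemma err0 {R : realType} (x : R^nat) (k : nat) : 0 <= x k -> err x 0 k = x k.
Proof. by rewrite /err subr0 => /ger0_norm. Qed.

Lemma Rorder_ge1_geometric {R : realType} (x : R^nat) (xs q : R) (p : nat) :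
  (0 < p)%N -> 0 < q < 1 -> x @ \oo --> xs ->
  (\forall k \near \oo, err x xs (k + p) <= q ^+ p * err x xs k) ->
  Rorder_ge 1 x xs.
Proof.
move=> p0 /andP[q0 q1] xcvg rec.
have [K _ HK] : \forall k \near \oo,
    err x xs (k + p) <= q ^+ p * err x xs k /\ err x xs k <= 1.
  by apply: filterI => //; exact: near_err_le.
(* With this [C], [C * q ^+ j >= 1] for [j < K + p], while the errors from [K] on are at most 1. *)
pose C := (q ^+ (K + p))^-1.
have C0 : 0 < C by rewrite invr_gt0 exprn_gt0.
have Cq0 k : 0 < C * q ^+ k by rewrite mulr_gt0// exprn_gt0.
exists (fun k => C * q ^+ k); split => //.
- exists K => //=; apply: (step_ind _ _ _ p0) => [j /andP[Kj jKp]|k Kk IH].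
    apply: (le_trans (HK j Kj).2).
    rewrite mulrC ler_pdivlMr ?exprn_gt0// mul1r.
    by apply: ler_wiXn2l; rewrite ?ltW// ltnW.
  apply: (le_trans (HK k Kk).1).
  by rewrite exprD mulrA [leRHS]mulrC ler_pM2l ?exprn_gt0.
- by apply: cvg_geometric; rewrite gtr0_norm.
- left; split => //.
  rewrite (limn_esup_cst _ q%:E) ?lte_fin// => k.
  rewrite !err0 ?ltW// exprS; congr (_%:E).
  by field; rewrite expf_neq0 ?gt_eqF.
Qed.

Lemma Rorder_ge_superlinear {R : realType} (x : R^nat) (xs alpha L : R)
    (p : nat) :
  (0 < p)%N -> 1 < alpha -> 0 < L -> x @ \oo --> xs ->
  (\forall k \near \oo,
     err x xs (k + p) <= L * err x xs k `^ (alpha ^+ p)) ->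
  Rorder_ge alpha x xs.
Proof.
move=> p0 a1 L0 xcvg rec.
have a0 : 0 < alpha by rewrite (lt_trans _ a1).
have A1 : 1 < alpha ^+ p by rewrite exprn_egt1// -lt0n.
pose l := - ln L / (alpha ^+ p - 1).
have lE : ln L + alpha ^+ p * l = l.
  by rewrite /l; field; rewrite subr_eq0 gt_eqF.
clearbody l.
have [K _ HK] : \forall k \near \oo,
    err x xs (k + p) <= L * err x xs k `^ (alpha ^+ p) /\
    err x xs k <= expR (l - 1).
  by apply: filterI => //; apply: near_err_le => //; exact: expR_gt0.
(* Then [s * alpha ^+ j <= 1] for [j < K + p], which matches the bound [expR (l - 1)] on the
   errors. *)
pose s := (alpha ^+ (K + p))^-1.
have s0 : 0 < s by rewrite invr_gt0 exprn_gt0.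
exists (fun k => expR (l - s * alpha ^+ k)); split => //.
- by move=> k; exact: expR_gt0.
- exists K => //=; apply: (step_ind _ _ _ p0) => [j /andP[Kj jKp]|k Kk IH].
    apply: (le_trans (HK j Kj).2).
    rewrite ler_expR lerD2l lerN2 mulrC ler_pdivrMr ?exprn_gt0// mul1r.
    by apply: ler_weXn2l; rewrite ?ltW// ltnW.
  apply: (le_trans (HK k Kk).1).
  have -> : expR (l - s * alpha ^+ (k + p)) =
      L * expR (l - s * alpha ^+ k) `^ (alpha ^+ p).
    rewrite -expRM -[in RHS](@lnK _ L) ?posrE// -expRD -{1}lE exprD.
    by congr expR; ring.
  rewrite ler_pM2l// ge0_ler_powR ?nnegrE ?expR_ge0 ?normr_ge0//.
  by rewrite ltW// (lt_trans _ A1).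
(* With [t = s * alpha ^+ k], the inequality [t <= 1 + t <= expR t] gives [expR (- t) <= t^-1], a
   geometric bound. *)
- apply: (@squeeze_cvgr _ _ _ _ (cst 0)
      (geometric (expR l / s) alpha^-1)).
  + near=> k; rewrite expR_ge0/= expRD expRN exprVn -mulrA -invfM.
    rewrite ler_pM2l ?expR_gt0// lef_pV2 ?posrE ?expR_gt0 ?mulr_gt0 ?exprn_gt0//.
    by rewrite (le_trans _ (expR_ge1Dx _))// lerDr.
  + exact: cvg_cst.
  + by apply: cvg_geometric; rewrite gtr0_norm ?invr_gt0// invf_lt1.
- right; split => //.
  (* The terms [s * alpha ^+ k.+1] cancel in the exponent of the quotient. *)
  rewrite (limn_esup_cst _ (expR ((1 - alpha) * l))%:E) ?ltry// => k.
  rewrite !err0 ?expR_ge0// -expRM -expRN -expRD exprS; congr (expR _)%:E.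
  by ring.
Unshelve. all: by end_near. Qed.

Theorem theorem1 (R : realType) (x : R^nat) (xs : R) (p : nat) (alpha : R)
    (xcvg : x @ \oo --> xs)
    (xneq : \forall k \near \oo, x k != xs)
    (p_gt0 : (0 < p)%N)
    (alpha_ge1 : 1 <= alpha)
    (xQ : pstep_Qorder_ge p alpha x xs) :
  Rorder_ge alpha x xs.
Proof.
case: xQ => -[a1 /limn_esup_lt_bound[r]].
  rewrite {}a1 /Qfactor eqxx lte_fin => r1 rec.
  (* The bound [r] need not be positive; the maximum is, and stays below 1. *)
  pose q := Num.max r (1 / 2).
  have q0 : 0 < q by rewrite lt_max divr_gt0 ?orbT.
  apply: (Rorder_ge1_geometric _ _ q p) => //.
    by rewrite q0 gt_max r1; lra.
  apply: filterS2 xneq rec => k /err_gt0 ek0 Qr.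
  rewrite -ler_pdivrMr// -powR_mulrn ?(ltW q0)// -[p%:R]invrK.
  apply: le_powR_inv; rewrite ?invr_gt0 ?ltr0n//.
    by rewrite divr_ge0 ?normr_ge0.
  by rewrite le_max Qr.
rewrite /Qfactor gt_eqF// => _ rec.
have A1 : 1 < alpha ^+ p by rewrite exprn_egt1// -lt0n.
pose c := (alpha - 1) / (alpha ^+ p - 1).
have c0 : 0 < c by rewrite divr_gt0// subr_gt0.
(* The power [c^-1] inverts the exponent [c] in [Qfactor]; the maximum with 1 ensures a positive
   constant. *)
apply: (Rorder_ge_superlinear _ _ _ (Num.max r 1 `^ c^-1) p) => //.
  by rewrite powR_gt0// lt_max ltr01 orbT.
apply: filterS2 xneq rec => k /err_gt0 ek0 Qr.
rewrite -ler_pdivrMr ?powR_gt0//.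
apply: le_powR_inv => //; first by rewrite divr_ge0 ?powR_ge0 ?normr_ge0.
by rewrite le_max Qr.
Qed.
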